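(* Consider the optimization problem $$\min_{w_1,\dots,w_K}\ \sum_{k=1}^K \big(J_k(w_k)+R_k(w_k)\big)\quad\text{subject to}\quad \sum_{k\in\mathcal{C}_e}(B_{e,k}w_k-b_{e,k})=0,\quad e=1,\dots,E,$$ and the objects $\mathcal{B},\mathcal{A},\mathcal{U}_1,\Sigma,b,\mathcal{J},\mathcal{R},\delta,\nu$ described in the context. Suppose the cost assumption, the sub-network assumption and the strong duality assumption stated in the context hold, and furthermore that $R_k=0$ for every $k$ and that for every $k$ the matrix obtained by stacking vertically the matrices $B_{e,k}$, $e\in\mathcal{E}_k=\{e: k\in\mathcal{C}_e\}$, has full row rank. Suppose the constant step-sizes $\mu_w,\mu_v>0$ satisfy $$\mu_w<\frac{1}{2\delta-\nu},\qquad \mu_v<\frac{\nu}{\lambda_{\max}(\mathcal{B}^{\mathsf T}\mathcal{B})}.$$ Let $(\mathsf{w}_i,\mathsf{y}_i,\mathsf{x}_i)$ be generated as follows: $\mathsf{w}_{-1},\mathsf{y}_{-1}$ are arbitrary, $\mathsf{w}_0=\mathrm{prox}_{\mu_w\mathcal{R}}\big(\mathsf{w}_{-1}-\mu_w\nabla\mathcal{J}(\mathsf{w}_{-1})-\mu_w\mathcal{B}^{\mathsf T}\mathsf{y}_{-1}\big)$, $\mathsf{y}_0=\mathsf{y}_{-1}+\mu_v(\mathcal{B}\mathsf{w}_0-b)$, $\mathsf{x}_0=0$, and for $i\ge1$ \begin{align*} \mathsf{w}_i&=\mathrm{prox}_{\mu_w\mathcal{R}}\big(\mathsf{w}_{i-1}-\mu_w\nabla\mathcal{J}(\mathsf{w}_{i-1})-\mu_w\mathcal{B}^{\mathsf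 T}\mathsf{y}_{i-1}\big),\\ \mathsf{x}_i&=\mathsf{x}_{i-1}-\tfrac{1}{\mu_v}\mathcal{U}_1^{\mathsf T}\big(\mathsf{y}_{i-1}+\mu_v(\mathcal{B}\mathsf{w}_i-b)+\mu_v\mathcal{U}_1\Sigma\mathsf{x}_{i-1}\big),\\ \mathsf{y}_i&=\mathsf{y}_{i-1}+\mu_v(\mathcal{B}\mathsf{w}_i-b)+\mu_v\mathcal{U}_1\Sigma\mathsf{x}_i \end{align*} (here $\mathrm{prox}_{\mu_w\mathcal{R}}$ is the identity since $\mathcal{R}=0$). Let $(\mathsf{w}^\star,\mathsf{y}^\star,\mathsf{x}^\star)$ satisfy the optimality conditions (with $g^\star=0$) stated in the context, and put $\tilde{\mathsf{w}}_i=\mathsf{w}^\star-\mathsf{w}_i$, $\tilde{\mathsf{y}}_i=\mathsf{y}^\star-\mathsf{y}_i$, $\tilde{\mathsf{x}}_i=\mathsf{x}^\star-\mathsf{x}_i$. Then there is a constant $C_0>0$ such that for all $i\geq 0$ $$\|\tilde{\mathsf{w}}_i\|_{C_w}^2+\|\tilde{\mathsf{y}}_i\|^2_{\mu_w/\mu_v}+\|\tilde{\mathsf{x}}_i\|^2_{\mu_w\mu_v\Sigma}\ \le\ \gamma^i C_0,$$ where $C_w=I-\mu_w\mu_v\mathcal{B}^{\mathsf T}\mathcal{B}>0$ (positive definite) and $$\gamma=\max\{\gamma_1,\gamma_2,1-\lambda_r\}<1,\qquad \gamma_1=1-\mu_w\nu(1-\delta\mu_w),\qquad \gamma_2=1-\mu_w\mu_v\lambda_{\min}(\mathcal{B}\mathcal{B}^{\mathsf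 T}),$$ with $\lambda_r$ the smallest non-zero eigenvalue of $\frac12(I-\mathcal{A})$.
   Context: Setting. There are $K$ agents forming an undirected graph; $\mathcal{N}_k$ denotes the neighborhood of agent $k$, including $k$ itself. There are $E$ constraints; $\mathcal{C}_e\subseteq\{1,\dots,K\}$ is the nonempty set of agents involved in constraint $e$, $N_e=|\mathcal{C}_e|$. For $k\in\mathcal{C}_e$, $B_{e,k}\in\mathbb{R}^{S_e\times Q_k}$ and $b_{e,k}\in\mathbb{R}^{S_e}$. The variables are $w_k\in\mathbb{R}^{Q_k}$, stacked as $\mathsf{w}=\mathrm{col}\{w_k\}_{k=1}^K$. The functions are $J_k:\mathbb{R}^{Q_k}\to\mathbb{R}$ and $R_k:\mathbb{R}^{Q_k}\to\mathbb{R}\cup\{+\infty\}$; $\mathcal{J}(\mathsf{w})=\sum_kJ_k(w_k)$, $\mathcal{R}(\mathsf{w})=\sum_kR_k(w_k)$, so $\nabla\mathcal{J}(\mathsf{w})=\mathrm{col}\{\nabla J_k(w_k)\}_{k=1}^K$. Cost assumption. $\mathcal{J}$ is convex and differentiable with $\|\nabla\mathcal{J}(\mathsf{w})-\nabla\mathcal{J}(\mathsf{w}')\|\le\delta\|\mathsf{w}-\mathsf{w}'\|$ and $(\mathsf{w}-\mathsf{w}')^{\mathsf T}\nabla\mathcal{J}(\mathsf{w})\ge\mathcal{J}(\mathsf{w})-\mathcal{J}(\mathsf{w}')+\frac{\nu}{2}\|\mathsf{w}-\mathsf{w}'\|^2$ for all $\mathsf{w},\mathsf{w}'$, where $\delta\ge\nu>0$.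 Each $R_k$ is a proper closed convex function. Sub-network assumption. The graph is undirected and the subgraph induced on each $\mathcal{C}_e$ is connected. Strong duality assumption. With Lagrangian $\mathcal{L}(\mathsf{w},\{v^e\}_{e=1}^E)=\sum_{k}\big(J_k(w_k)+R_k(w_k)\big)+\sum_{e=1}^E(v^e)^{\mathsf T}\sum_{k\in\mathcal{C}_e}(B_{e,k}w_k-b_{e,k})$, $v^e\in\mathbb{R}^{S_e}$, the saddle point problem $\min_{\mathsf{w}}\max_{\{v^e\}}\mathcal{L}$ has a solution and strong duality holds. Combination matrices. For each $e$, $A_e=[a_{e,sk}]_{s,k\in\mathcal{C}_e}\in\mathbb{R}^{N_e\times N_e}$ is symmetric, doubly stochastic (nonnegative entries, rows and columns sum to one) and primitive (some power has all entries positive), with $a_{e,sk}=0$ if $s\notin\mathcal{N}_k\cap\mathcal{C}_e$. Put $\mathcal{A}=\mathrm{blkdiag}\{A_e\otimes I_{S_e}\}_{e=1}^E$, of size $N=\sum_eN_eS_e$. Write the eigendecomposition $\frac12(I_N-\mathcal{A})=\mathcal{U}_1\Sigma\mathcal{U}_1^{\mathsf T}$ where $\Sigma=\mathrm{diag}\{\lambda_1,\dots,\lambda_r\}$ contains the non-zero eigenvalues $\lambda_r\le\cdots\le\lambda_1$ of $\frac12(I_N-\mathcal{A})$ and $\mathcal{U}_1\in\mathbb{R}^{N\times r}$ has the corresponding orthonormal eigenvectors as columns ($\mathcal{U}_1^{\mathsf T}\mathcal{U}_1=I$). Stacked quantities. $\mathsf{y}\in\mathbb{R}^N$ is stacked as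 $\mathsf{y}=\mathrm{col}\{\mathsf{y}^e\}_{e=1}^E$, $\mathsf{y}^e=\mathrm{col}\{v^e_k\}_{k\in\mathcal{C}_e}$ with $v^e_k\in\mathbb{R}^{S_e}$; $\mathsf{x}\in\mathbb{R}^r$. $b=\mathrm{col}\{b_e\}_{e=1}^E$, $b_e=\mathrm{col}\{b_{e,k}\}_{k\in\mathcal{C}_e}$. $\mathcal{B}$ is the block matrix with blocks $\mathcal{B}_{ek}\in\mathbb{R}^{N_eS_e\times Q_k}$, $e=1,\dots,E$, $k=1,\dots,K$, where $\mathcal{B}_{ek}$ is the block column, indexed by $k'\in\mathcal{C}_e$, whose $k'$-th block (of size $S_e\times Q_k$) is $B_{e,k}$ if $k\in\mathcal{C}_e$ and $k'=k$, and $0$ otherwise. Optimality conditions for $(\mathsf{w}^\star,\mathsf{y}^\star,\mathsf{x}^\star)$: for some subgradient $g^\star\in\partial\mathcal{R}(\mathsf{w}^\star)$, $\nabla\mathcal{J}(\mathsf{w}^\star)+g^\star+\mathcal{B}^{\mathsf T}\mathsf{y}^\star=0$, $\ \mathcal{U}_1^{\mathsf T}\mathsf{y}^\star=0$, $\ (\mathcal{B}\mathsf{w}^\star-b)+\mathcal{U}_1\Sigma\mathsf{x}^\star=0$. Notation: $\mathrm{prox}_{\mu\mathcal{R}}(x)=\arg\min_u\big(\mathcal{R}(u)+\frac{1}{2\mu}\|x-u\|^2\big)$; $\|x\|_D^2=x^{\mathsf T}Dx$ for a positive definite matrix (or positive scalar) $D$; $\lambda_{\max},\lambda_{\min}$ denote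 largest and smallest eigenvalues. *)

(* Defs.v *)
From HB Require Import structures.
From mathcomp Require Import all_boot all_order all_algebra.
From mathcomp Require Import mxtens.
From mathcomp Require Import all_classical all_reals all_analysis.
Import numFieldNormedType.Exports.

Set Implicit Arguments.
Unset Strict Implicit.
Unset Printing Implicit Defensive.

Import Order.TTheory GRing.Theory Num.Theory.

Local Open Scope classical_set_scope.
Local Open Scope ring_scope.

(* Vectors of R^n are columns.  MathComp-Analysis puts the sup norm on matrices;
   it is used only for the (norm-independent) topology and differentiability,
   all metric statements go through the Euclidean norm [enorm]. *)
Section Euclidean.
Context {R : realType}.

Definition dotv n (x y : 'cV[R]_n) : R := (x^T *m y) 0 0.

Definition enorm n (x : 'cV[R]_n) : R := Num.sqrt (dotv x x).

Definition wnormsq n (D : 'M[R]_n) (x : 'cV[R]_n) : R := (x^T *m D *m x) 0 0.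

Definition posdef n (D : 'M[R]_n) : Prop :=
  D^T = D /\ forall x : 'cV[R]_n, x != 0 -> 0 < wnormsq D x.

(* Only used on symmetric matrices of positive size, whose (finite, nonempty)
   spectrum is real, so that the sup and the inf are attained. *)
Definition lambda_max n (M : 'M[R]_n) : R := sup [set a | eigenvalue M a].

Definition lambda_min n (M : 'M[R]_n) : R := inf [set a | eigenvalue M a].

Definition lambda_min_nonzero n (M : 'M[R]_n) : R :=
  inf [set a | eigenvalue M a /\ a != 0].

Definition gradient n (f : 'cV[R]_n -> R) (x : 'cV[R]_n) : 'cV[R]_n :=
  \col_i 'D_(delta_mx i 0) (f : 'cV[R]_n -> R^o) x.

End Euclidean.

Section ConvexAnalysis.
Context {R : realType} {n : nat}.
Implicit Types (f : 'cV[R]_n -> \bar R) (x u g : 'cV[R]_n).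
Local Open Scope ereal_scope.

Definition proper f : Prop :=
  (forall x, -oo < f x) /\ exists x, f x < +oo.

(* For proper f; recall that 0 * +oo = 0 in \bar R. *)
Definition convex_ereal f : Prop :=
  forall (t : R) x u, (0 <= t <= 1)%R ->
    f (t *: x + (1 - t) *: u)%R <= t%:E * f x + (1 - t)%:E * f u.

(* An extended-valued function is closed (i.e., has a closed epigraph) iff it
   is lower semicontinuous. *)
Definition proper_closed_convex f : Prop :=
  [/\ proper f, lower_semicontinuous f & convex_ereal f].

Definition is_subgradient f x g : Prop :=
  forall u, f x + (dotv g (u - x))%:E <= f u.

(* u = prox_{mu f}(x), as membership in the argmin *)
Definition is_prox (mu : R) f x u : Prop :=
  forall u', f u + ((2 * mu)^-1 * enorm (x - u) ^+ 2)%:E <=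
             f u' + ((2 * mu)^-1 * enorm (x - u') ^+ 2)%:E.

End ConvexAnalysis.

(* Agents are 'I_K, constraints are 'I_E; agent k holds a vector in R^(Q k),
   constraint e has dimension S e and involves the agents in C e. *)

Definition neighbors K (adj : rel 'I_K) (k : 'I_K) : {set 'I_K} :=
  finset (fun s => (s == k) || adj s k).

Definition subnetwork_assumption K E (adj : rel 'I_K)
    (C : 'I_E -> {set 'I_K}) : Prop :=
  symmetric adj /\
  forall e s t, s \in C e -> t \in C e ->
    connect [rel k l | [&& k \in C e, l \in C e & adj k l]] s t.

Section Costs.
Context {R : realType} {K : nat} {Q : 'I_K -> nat}.
Implicit Types (w : 'cV[R]_(\sum_k Q k)).

Definition calJ (J : forall k, 'cV[R]_(Q k) -> R) w : R :=
  \sum_k J k (submxcol w k).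

Definition calR (Rf : forall k, 'cV[R]_(Q k) -> \bar R) w : \bar R :=
  (\sum_k Rf k (submxcol w k))%E.

Definition cost_assumption (J : forall k, 'cV[R]_(Q k) -> R)
    (Rf : forall k, 'cV[R]_(Q k) -> \bar R) (delta nu : R) : Prop :=
  [/\ 0 < nu <= delta,
      convex_function setT (calJ J : 'cV[R]_(\sum_k Q k) -> R^o) /\
      (forall w, differentiable (calJ J : 'cV[R]_(\sum_k Q k) -> R^o) w),
      forall w w', enorm (gradient (calJ J) w - gradient (calJ J) w')
                   <= delta * enorm (w - w'),
      forall w w', calJ J w - calJ J w' + nu / 2 * enorm (w - w') ^+ 2
                   <= dotv (w - w') (gradient (calJ J) w)
    & forall k, proper_closed_convex (Rf k)].

End Costs.

Section Constraints.
Context {R : realType} {K E : nat} {Q : 'I_K -> nat} {S : 'I_E -> nat}.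
Variable C : 'I_E -> {set 'I_K}.
(* The values of B e k and b e k for k \notin C e are irrelevant. *)
Variable B : forall (e : 'I_E) (k : 'I_K), 'M[R]_(S e, Q k).
Variable b : forall (e : 'I_E) (k : 'I_K), 'cV[R]_(S e).

Local Notation dimN := (\sum_e (#|C e| * S e)%N)%N.

Definition Lagrangian (J : forall k, 'cV[R]_(Q k) -> R)
    (Rf : forall k, 'cV[R]_(Q k) -> \bar R)
    (w : 'cV[R]_(\sum_k Q k)) (v : forall e, 'cV[R]_(S e)) : \bar R :=
  (\sum_k ((J k (submxcol w k))%:E + Rf k (submxcol w k)) +
   (\sum_e dotv (v e)
      (\sum_(k in C e) (B e k *m submxcol w k - b e k))%R)%R%:E)%E.

Definition strong_duality_assumption (J : forall k, 'cV[R]_(Q k) -> R)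
    (Rf : forall k, 'cV[R]_(Q k) -> \bar R) : Prop :=
  let L := Lagrangian J Rf in
  (exists w0 v0,
     (forall v, L w0 v <= L w0 v0)%E /\ (forall w, L w0 v0 <= L w v0)%E) /\
  ereal_inf (range (fun w => ereal_sup (range (fun v => L w v)))) =
  ereal_sup (range (fun v => ereal_inf (range (fun w => L w v)))).

(* The i-th row/column of A e corresponds to the i-th agent of C e. *)
Definition combination_matrix (adj : rel 'I_K) (e : 'I_E)
    (A : 'M[R]_#|C e|) : Prop :=
  [/\ A^T = A,
      (forall i j, 0 <= A i j) /\
      (forall i, \sum_j A i j = 1) /\ (forall j, \sum_i A i j = 1),
      exists m : nat, forall i j, 0 < (A ^+ m) i j
    & forall i j : 'I_#|C e|,
        enum_val i \notin neighbors adj (enum_val j) -> A i j = 0].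

Definition calA (A : forall e, 'M[R]_#|C e|) : 'M[R]_dimN :=
  \mxdiag_(e < E) tensmx (A e) (1%:M : 'M[R]_(S e)).

(* Rows of a block e are indexed by pairs (agent of C e, coordinate < S e),
   encoded by [mxtens_index], as for the Kronecker product. *)
Definition calB : 'M[R]_(dimN, \sum_k Q k) :=
  \mxblock_(e < E, k < K)
    \matrix_(i < #|C e| * S e, j < Q k)
      let: (k', s) := mxtens_unindex i in
      if enum_val k' == k then B e k s j else 0.

Definition calb : 'cV[R]_dimN :=
  \mxcol_(e < E)
    \col_(i < #|C e| * S e)
      let: (k', s) := mxtens_unindex i in b e (enum_val k') s 0.

Definition constraints_of (k : 'I_K) : {set 'I_E} :=
  finset (fun e => k \in C e).

Definition stackB (k : 'I_K) :
    'M[R]_(\sum_(j < #|constraints_of k|) S (enum_val j), Q k) :=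
  \mxcol_(j < #|constraints_of k|) B (enum_val j) k.

Definition eigendecomposition (A : forall e, 'M[R]_#|C e|) r
    (U1 : 'M[R]_(dimN, r)) (lam : 'rV[R]_r) : Prop :=
  [/\ U1^T *m U1 = 1%:M,
      2^-1 *: (1%:M - calA A) = U1 *m diag_mx lam *m U1^T,
      forall j, lam 0 j != 0
    & forall i j : 'I_r, (i <= j)%N -> lam 0 j <= lam 0 i].

Section Algorithm.
Context {r : nat}.
Variables (J : forall k, 'cV[R]_(Q k) -> R).
Variables (Rf : forall k, 'cV[R]_(Q k) -> \bar R).
Variables (U1 : 'M[R]_(dimN, r)) (lam : 'rV[R]_r).

Definition optimality_conditions (w : 'cV[R]_(\sum_k Q k)) (y : 'cV[R]_dimN)
    (x : 'cV[R]_r) : Prop :=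
  [/\ exists g, is_subgradient (calR Rf) w g /\
        gradient (calJ J) w + g + calB^T *m y = 0,
      U1^T *m y = 0
    & calB *m w - calb + U1 *m diag_mx lam *m x = 0].

(* wm and ym are the arbitrary values of w and y at time -1. *)
Definition algorithm_run (mu_w mu_v : R)
    (wm : 'cV[R]_(\sum_k Q k)) (ym : 'cV[R]_dimN)
    (w : nat -> 'cV[R]_(\sum_k Q k)) (y : nat -> 'cV[R]_dimN)
    (x : nat -> 'cV[R]_r) : Prop :=
  let w_step w0 y0 :=
    is_prox mu_w (calR Rf)
      (w0 - mu_w *: gradient (calJ J) w0 - mu_w *: (calB^T *m y0)) in
  (w_step wm ym (w 0%N) /\
   y 0%N = ym + mu_v *: (calB *m w 0%N - calb) /\
   x 0%N = 0) /\
  forall i : nat,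
    [/\ w_step (w i) (y i) (w i.+1),
        x i.+1 = x i - mu_v^-1 *:
          (U1^T *m (y i + mu_v *: (calB *m w i.+1 - calb)
                    + mu_v *: (U1 *m diag_mx lam *m x i)))
      & y i.+1 = y i + mu_v *: (calB *m w i.+1 - calb)
                 + mu_v *: (U1 *m diag_mx lam *m x i.+1)].

End Algorithm.

Definition Cw (mu_w mu_v : R) : 'M[R]_(\sum_k Q k) :=
  1%:M - (mu_w * mu_v) *: (calB^T *m calB).

Definition gamma1 (mu_w nu delta : R) : R :=
  1 - mu_w * nu * (1 - delta * mu_w).

Definition gamma2 (mu_w mu_v : R) : R :=
  1 - mu_w * mu_v * lambda_min (calB *m calB^T).

(* r is the number of non-zero eigenvalues of (I - A)/2, with multiplicity.
   When r = 0 (every constraint involves a single agent) there is no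
   lambda_r, and the term 1 - lambda_r is absent from the maximum. *)
Definition gamma (A : forall e, 'M[R]_#|C e|) (r : nat)
    (mu_w mu_v nu delta : R) : R :=
  let g := Num.max (gamma1 mu_w nu delta) (gamma2 mu_w mu_v) in
  if r == 0%N then g
  else Num.max g (1 - lambda_min_nonzero (2^-1 *: (1%:M - calA A))).

End Constraints.

(* Main.v *)
Require Import Defs.
From HB Require Import structures.
From mathcomp Require Import all_boot all_order all_algebra.
From mathcomp Require Import mxtens spectral complex ring lra.
From mathcomp Require Import all_classical all_reals all_analysis.
Import Order.TTheory GRing.Theory Num.Theory.
Local Open Scope ring_scope.

(* One iteration contracts the energy
     V = |w~|^2_{Cw} + (mu_w / mu_v) |y~|^2 + mu_w mu_v |x~|^2_Sigma
   by the factor gamma.  Put a = w~ - mu_w (grad J(w* ) - grad J(w)), so that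
   w~' = a - mu_w B^T y~, and z = y~ + mu_v B w~'.  Expanding the squares,
     |w~'|^2_{Cw} + (mu_w / mu_v) |z|^2
       = |a|^2 + (mu_w / mu_v) |y~|^2 - mu_w^2 |B^T y~|^2,
     |y~'|^2 + mu_v^2 |x~'|^2_Sigma
       = |z|^2 + mu_v^2 (|x~|^2_{Sigma (1 - Sigma)}
                         - |x~' - x~|^2_{Sigma (1 - Sigma)}).
   Co-coercivity of grad J bounds |a|^2 by gamma1 |w~|^2_{Cw}, the spectral
   theorem bounds |B^T y~|^2 below by lambda_min (B B^T) |y~|^2, where B has full
   row rank by the rank condition on each agent, and 0 < Sigma <= 1 because the
   combination matrices are stochastic. *)

Set Implicit Arguments.
Unset Strict Implicit.

(** * Euclidean inner product and spectral bounds for real symmetric matrices *)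

Section SymmetricMatrices.
Context {R : realType}.
Local Open Scope sesquilinear_scope.

Lemma dotvE n (x y : 'cV[R]_n) : dotv x y = \sum_i x i 0 * y i 0.
Proof. by rewrite /dotv mxE; apply: eq_bigr => i _; rewrite mxE. Qed.

Lemma dotvC n (x y : 'cV[R]_n) : dotv x y = dotv y x.
Proof. by rewrite !dotvE; apply: eq_bigr => i _; rewrite mulrC. Qed.

Lemma dotvv_ge0 n (x : 'cV[R]_n) : 0 <= dotv x x.
Proof. by rewrite dotvE sumr_ge0// => i _; rewrite -expr2 sqr_ge0. Qed.

Lemma dotvv_eq0 n (x : 'cV[R]_n) : (dotv x x == 0) = (x == 0).
Proof.
rewrite dotvE psumr_eq0; last by move=> i _; rewrite -expr2 sqr_ge0.
apply/allP/eqP => [x0|-> i _]; last by rewrite mxE mulr0 eqxx.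
apply/matrixP => i j; rewrite ord1 mxE.
by have /eqP := x0 i (mem_index_enum i); rewrite -expr2 => /eqP; rewrite sqrf_eq0 => /eqP.
Qed.

Lemma dotvv_gt0 n (x : 'cV[R]_n) : (0 < dotv x x) = (x != 0).
Proof. by rewrite lt_def dotvv_ge0 andbT dotvv_eq0. Qed.

Lemma enorm_sqr n (x : 'cV[R]_n) : enorm x ^+ 2 = dotv x x.
Proof. by rewrite sqr_sqrtr// dotvv_ge0. Qed.

(** [M] is complexified to a hermitian matrix, whose unitary diagonalisation has a real diagonal.
    The eigenbasis may be complex, so [c i] is the squared modulus of the i-th coordinate of [x] in
    it. *)
Lemma symmetric_quadratic_diag n (M : 'M[R]_n) : M^T = M ->
  exists d : 'I_n -> R, (forall i, eigenvalue M (d i)) /\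
  forall x : 'cV[R]_n, exists c : 'I_n -> R,
    [/\ forall i, 0 <= c i, dotv x x = \sum_i c i
      & wnormsq M x = \sum_i d i * c i].
Proof.
move=> Msym; pose f : {rmorphism R -> R[i]} := real_complex R; pose MC : 'M[R[i]]_n := map_mx f M.
have conjf k : (f k)^* = f k by exact: conjc_real.
have MCherm : MC \is hermitianmx n false (@Num.conj _).
  apply/is_hermitianmxP; rewrite expr0 scale1r.
  by apply/matrixP => i j; rewrite !mxE conjf -[in RHS]Msym mxE.
have := hermitian_normalmx MCherm => /orthomx_spectralP.
have Pu := spectral_unitarymx MC; have dR := hermitian_spectral_diag_real MCherm.
move: Pu dR; set P := spectralmx MC; set d := spectral_diag MC => Pu dR.
rewrite invmx_unitary// => MCE.
have [d' d'E] : exists d' : 'I_n -> R, forall i, d 0 i = f (d' i).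
  by exists (fun i => complex.Re (d 0 i)) => i; apply/esym/RRe_real/mxOverP.
have PPt := unitarymxP Pu.
have PtP : P^t* *m P = 1%:M by apply: mulmx1C.
exists d'; split=> [i|x].
  rewrite -(eigenvalue_map f) -/MC -d'E.
  apply/eigenvalueP; exists (row i P).
    rewrite MCE -!row_mul !mulmxA PPt mul1mx.
    by apply/rowP => j; rewrite mul_diag_mx !mxE.
  apply/eqP => P0; have /rowP/(_ i) := row_mul i P (P^t*).
  rewrite PPt P0 mul0mx !mxE eqxx => /eqP; rewrite oner_eq0//.
pose z : 'cV[R[i]]_n := P *m map_mx f x.
have xtC : map_mx f x^T = (map_mx f x)^t*.
  by apply/matrixP => i j; rewrite !mxE conjf.
have ztE : z^t* = map_mx f x^T *m P^t*.
  by rewrite /z trmx_mul map_mxM -xtC.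
exists (fun i => complex.Re (`|z i 0| ^+ 2)).
have ReE i : f (complex.Re (`|z i 0| ^+ 2)) = `|z i 0| ^+ 2.
  exact/RRe_real/ger0_real/exprn_ge0.
split=> [i||].
- by rewrite -ler0c -[X in 0 <= X]/(f _) ReE exprn_ge0.
- apply: (fmorph_inj f); rewrite rmorph_sum/=.
  under eq_bigr do rewrite ReE.
  transitivity ((z^t* *m z) 0 0).
    rewrite ztE /z mulmxA -(mulmxA _ _ P) PtP mulmx1 -map_mxM mxE//.
  by rewrite mxE; apply: eq_bigr => i _; rewrite !mxE mulrC normCK.
- apply: (fmorph_inj f); rewrite rmorph_sum/=.
  under eq_bigr do rewrite rmorphM ReE.
  transitivity ((z^t* *m diag_mx d *m z) 0 0).
    rewrite ztE /z mulmxA -(mulmxA _ (P^t*)) -(mulmxA _ (P^t* *m _)) -MCE.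
    by rewrite -!map_mxM mxE.
  rewrite mxE; apply: eq_bigr => i _; rewrite mul_mx_diag !mxE d'E normCK.
  by rewrite -/f; ring.
Qed.

Lemma inf_least (A : set R) a : A a -> (forall z, A z -> a <= z) -> inf A = a.
Proof.
move=> Aa lba; apply/le_anti/andP; split.
  by apply: ge_inf => //; exists a.
by apply: lb_le_inf => //; exists a.
Qed.

Lemma sup_greatest (A : set R) a : A a -> (forall z, A z -> z <= a) -> sup A = a.
Proof.
move=> Aa uba; apply/le_anti/andP; split.
  by apply: ge_sup => //; exists a.
by apply: ub_le_sup => //; exists a.
Qed.

Lemma eigenvalue_quadratic n (M : 'M[R]_n) a : eigenvalue M a ->
  exists2 x : 'cV[R]_n, x != 0 & wnormsq M x = a * dotv x x.
Proof.
move=> /eigenvalueP[v vM v0]; exists v^T; first by rewrite trmx_eq0.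
by rewrite /wnormsq /dotv trmxK vM -scalemxAl mxE.
Qed.

Lemma lambda_min_quadratic n (M : 'M[R]_n) : M^T = M -> (0 < n)%N ->
  eigenvalue M (lambda_min M) /\
  forall x, lambda_min M * dotv x x <= wnormsq M x.
Proof.
move=> /symmetric_quadratic_diag[d [dM dE]] n0.
case: (@arg_minP _ _ 'I_n (Ordinal n0) xpredT d) => // i _ di.
have dle x : d i * dotv x x <= wnormsq M x.
  have [c [c0 -> ->]] := dE x; rewrite mulr_sumr ler_sum// => j _.
  by rewrite ler_wpM2r//; exact: di.
(* Every eigenvalue is the Rayleigh quotient of some nonzero vector, hence at least [d i]; so the
   infimum is attained at [d i]. *)
suff -> : lambda_min M = d i by split; [exact: dM | exact: dle].
apply: inf_least => [|a /=]; first exact: dM.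
move=> /eigenvalue_quadratic[x x0 xE].
by move: (dle x); rewrite xE ler_pM2r// dotvv_gt0.
Qed.

Lemma lambda_max_quadratic n (M : 'M[R]_n) : M^T = M -> (0 < n)%N ->
  forall x, wnormsq M x <= lambda_max M * dotv x x.
Proof.
move=> /symmetric_quadratic_diag[d [dM dE]] n0.
case: (@arg_maxP _ _ 'I_n (Ordinal n0) xpredT d) => // i _ di.
have dge x : wnormsq M x <= d i * dotv x x.
  have [c [c0 -> ->]] := dE x; rewrite mulr_sumr ler_sum// => j _.
  by rewrite ler_wpM2r//; exact: di.
suff -> : lambda_max M = d i by exact: dge.
apply: sup_greatest => [|a /=]; first exact: dM.
move=> /eigenvalue_quadratic[x x0 xE].
by move: (dge x); rewrite xE ler_pM2r// dotvv_gt0.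
Qed.

Lemma wnormsq_gram m n (B : 'M[R]_(m, n)) x :
  wnormsq (B^T *m B) x = dotv (B *m x) (B *m x).
Proof. by rewrite /wnormsq /dotv trmx_mul !mulmxA. Qed.

Lemma gram_le_lambda_max m n (B : 'M[R]_(m, n)) x :
  dotv (B *m x) (B *m x) <= lambda_max (B^T *m B) * dotv x x.
Proof.
rewrite -wnormsq_gram; case: n B x => [|n] B x.
  by rewrite (flatmx0 x) /wnormsq /dotv mulmx0 mxE mulmx0 mxE mulr0.
by apply: lambda_max_quadratic => //; rewrite trmx_mul trmxK.
Qed.

Lemma gram_ge_lambda_min m n (B : 'M[R]_(m, n)) y :
  lambda_min (B *m B^T) * dotv y y <= dotv (B^T *m y) (B^T *m y).
Proof.
rewrite -{1}(trmxK B) -wnormsq_gram trmxK; case: m B y => [|m] B y.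
  by rewrite (flatmx0 y) /wnormsq /dotv mulmx0 mxE mulmx0 mxE mulr0.
have sym : (B *m B^T)^T = B *m B^T by rewrite trmx_mul trmxK.
by have [_] := lambda_min_quadratic sym isT; apply.
Qed.

(** The least eigenvalue equals [|B^T y|^2 / |y|^2] for some [y != 0], and [B^T y] cannot vanish
    when the rows of [B] are independent. *)
Lemma lambda_min_gram_gt0 m n (B : 'M[R]_(m, n)) : (0 < m)%N -> row_free B ->
  0 < lambda_min (B *m B^T).
Proof.
move=> m0 Bfree.
have [|/eigenvalue_quadratic[y y0 yE] _] := @lambda_min_quadratic _ (B *m B^T) _ m0.
  by rewrite trmx_mul trmxK.
rewrite -(pmulr_lgt0 _ (_ : 0 < dotv y y)) ?dotvv_gt0// -yE.
rewrite -{1}(trmxK B) wnormsq_gram dotvv_gt0; apply: contra_neq y0 => By0.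
apply: trmx_inj; rewrite trmx0; apply: (row_free_inj Bfree).
by rewrite mul0mx -[B]trmxK -trmx_mul By0 trmx0.
Qed.

(** If [v] is a left eigenvector for [a != 0], then [v *m U] is nonzero and is a left eigenvector of
    [diag_mx lam]. Conversely, each column of [U] is an eigenvector. *)
Lemma eigenvalue_nonzero_diag n r (U : 'M[R]_(n, r)) (lam : 'rV[R]_r) :
  U^T *m U = 1%:M -> (forall j, lam 0 j != 0) -> forall a,
  eigenvalue (U *m diag_mx lam *m U^T) a /\ a != 0 <-> exists j, a = lam 0 j.
Proof.
move=> UU lam0 a; split=> [[/eigenvalueP[v vM v0] a0]|[j ->]].
  have vU : (v *m U) *m diag_mx lam = a *: (v *m U).
    have := congr1 (mulmx^~ U) vM; rewrite -!mulmxA UU mulmx1 !mulmxA => ->.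
    by rewrite scalemxAl.
  have [j vUj] : exists j, (v *m U) 0 j != 0.
    apply/existsP; apply: contra_neqT v0 => /existsPn vU0.
    have {}vU0 : v *m U = 0.
      by apply/rowP => j; have := vU0 j; rewrite negbK [RHS]mxE => /eqP.
    by apply: (scalerI a0); rewrite scaler0 -vM !mulmxA vU0 !mul0mx.
  exists j; have /rowP/(_ j) := vU; rewrite mul_mx_diag [LHS]mxE [RHS]mxE.
  by rewrite [RHS]mulrC => /(mulfI vUj).
split=> //; apply/eigenvalueP; exists (row j U^T).
  rewrite -row_mul !mulmxA UU mul1mx.
  by apply/rowP => k; rewrite mul_diag_mx !mxE.
apply/eqP => U0; have /rowP/(_ j) := row_mul j U^T U.
by rewrite UU U0 mul0mx !mxE eqxx => /eqP; rewrite oner_eq0.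
Qed.

Lemma lambda_min_nonzero_diag n r (U : 'M[R]_(n, r)) (lam : 'rV[R]_r) :
  U^T *m U = 1%:M -> (forall j, lam 0 j != 0) -> (0 < r)%N ->
  let l := lambda_min_nonzero (U *m diag_mx lam *m U^T) in
  (exists j, l = lam 0 j) /\ forall j, l <= lam 0 j.
Proof.
move=> UU lam0 r0 l; have E := eigenvalue_nonzero_diag UU lam0.
case: (@arg_minP _ _ 'I_r (Ordinal r0) xpredT (lam 0)) => // i _ mini.
suff -> : l = lam 0 i by split; [exists i | move=> j; exact: mini].
by apply: inf_least => [|a /E[j ->]]; [apply/E; exists i | exact: mini].
Qed.

End SymmetricMatrices.

(** * Gradient steps on strongly convex functions with Lipschitz gradient *)

Section StronglyConvexSmooth.
Context {R : realType} {n : nat}.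
Implicit Types (x y z u v w : 'cV[R]_n).

Lemma dotvDl x y z : dotv (x + y) z = dotv x z + dotv y z.
Proof. by rewrite /dotv linearD mulmxDl mxE. Qed.

Lemma dotvZl (a : R) x y : dotv (a *: x) y = a * dotv x y.
Proof. by rewrite /dotv linearZ -scalemxAl mxE. Qed.

Lemma dotvNl x y : dotv (- x) y = - dotv x y.
Proof. by rewrite -scaleN1r dotvZl mulN1r. Qed.

Lemma dotvDr x y z : dotv x (y + z) = dotv x y + dotv x z.
Proof. by rewrite /dotv mulmxDr mxE. Qed.

Lemma dotvZr (a : R) x y : dotv x (a *: y) = a * dotv x y.
Proof. by rewrite dotvC dotvZl dotvC. Qed.

Lemma dotvNr x y : dotv x (- y) = - dotv x y.
Proof. by rewrite dotvC dotvNl dotvC. Qed.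

Definition dotv_bilinear := (dotvDl, dotvDr, dotvNl, dotvNr, dotvZl, dotvZr).

(** This form of Cauchy--Schwarz follows from [|x - c y|^2 >= 0] and [|x|^2 <= c^2 |y|^2]. *)
Lemma dotv_le_enorm (c : R) x y : 0 < c -> enorm x <= c * enorm y ->
  dotv x y <= c * dotv y y.
Proof.
move=> c0 xy.
have xy2 : dotv x x <= c ^+ 2 * dotv y y.
  rewrite -!enorm_sqr -exprMn ler_pXn2r ?nnegrE ?sqrtr_ge0//.
  by rewrite mulr_ge0 ?sqrtr_ge0 ?ltW.
have := dotvv_ge0 (x - c *: y).
rewrite !dotv_bilinear (dotvC y x) => sq.
rewrite -(ler_pM2l c0); lra.
Qed.

Variables (f : 'cV[R]_n -> R) (G : 'cV[R]_n -> 'cV[R]_n) (delta nu : R).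
Hypothesis nu_delta : 0 < nu <= delta.
Hypothesis G_lip : forall w u, enorm (G w - G u) <= delta * enorm (w - u).
Hypothesis f_sconvex : forall w u,
  f w - f u + nu / 2 * enorm (w - u) ^+ 2 <= dotv (w - u) (G w).

Let nu_gt0 : 0 < nu. Proof. by case/andP: nu_delta. Qed.
Let delta_gt0 : 0 < delta. Proof. by case/andP: nu_delta; apply: lt_le_trans. Qed.

Lemma gradient_ineq w u : f w - f u <= dotv (w - u) (G w).
Proof.
apply: le_trans (f_sconvex w u); rewrite lerDl enorm_sqr mulr_ge0 ?dotvv_ge0//.
by rewrite divr_ge0// ltW.
Qed.

Lemma gradient_strong_monotone w u :
  nu * dotv (w - u) (w - u) <= dotv (w - u) (G w - G u).
Proof.
have := f_sconvex w u; have := f_sconvex u w.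
rewrite !enorm_sqr -(opprB w u); set d := w - u; rewrite !dotv_bilinear; lra.
Qed.

(* Telescoping the gradient inequality along a subdivision of [w, w + d] into
   m steps replaces the usual integration of the derivative along the segment. *)
Lemma descent_subdivision w d (m k : nat) : (0 < m)%N ->
  f (w + (k%:R / m%:R) *: d) <= f w + k%:R / m%:R * dotv d (G w)
    + delta / 2 * ((k * k.+1)%:R / m%:R ^+ 2) * dotv d d.
Proof.
move=> m0; elim: k => [|k IH].
  by rewrite mul0r scale0r addr0 !mul0n !mul0r mulr0 mul0r !addr0.
rewrite -!exprVn in IH *; set s : R := m%:R^-1 in IH *.
have s0 : 0 < s by rewrite invr_gt0 ltr0n.
set p := w + (k%:R * s) *: d in IH; set q := w + _.
have qp : q - p = s *: d.
  by rewrite /q /p opprD addrACA subrr add0r -scalerBl -mulrBl -natrB// subSnn mul1r.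
have := gradient_ineq q p; rewrite qp dotvZl.
(* The gradient is taken at the far end [q] of the subinterval, at distance [(k+1) s |d|] from [w];
   summing these distances produces the factor [k (k+1) / 2]. *)
have : dotv (G q - G w) d <= (delta * (k.+1%:R * s)) * dotv d d.
  apply: dotv_le_enorm; first by rewrite !mulr_gt0 ?ltr0n.
  apply: le_trans (G_lip q w) _; rewrite /q addrC addKr -mulrA ler_pM2l//.
  rewrite /enorm dotvZl dotvZr mulrA -expr2 sqrtrM ?sqr_ge0// sqrtr_sqr.
  by rewrite ger0_norm// mulr_ge0// ltW.
rewrite dotvDl dotvNl !(dotvC _ d) => /(ler_wpM2l (ltW s0)) lip grad.
have -> : (k.+1 * k.+2)%:R = (k * k.+1)%:R + 2 * k.+1%:R :> R.
  by rewrite !natrM -!natr1; ring.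
move: IH lip grad; rewrite -[k.+1%:R]natr1; lra.
Qed.

(** For [k = m] the subdivision bound exceeds the claim by [(delta / 2) |d|^2 / m], which is made
    smaller than any [e > 0]. *)
Lemma descent w d :
  f (w + d) <= f w + dotv d (G w) + delta / 2 * dotv d d.
Proof.
apply/ler_addgt0Pr => e e0; pose c := delta / 2 * dotv d d.
have c0 : 0 <= c by rewrite mulr_ge0 ?dotvv_ge0// divr_ge0// ltW.
have [m m0 cm] : exists2 m : nat, (0 < m)%N & c / m%:R <= e.
  exists (Num.Def.archi_bound (c / e)).+1 => //.
  rewrite ler_pdivrMr ?ltr0n// mulrC -ler_pdivrMr//.
  apply/ltW/(lt_le_trans (archi_boundP _)); first by rewrite divr_ge0// ltW.
  by rewrite ler_nat.
have := descent_subdivision w d m m0.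
have mN0 : m%:R != 0 :> R by rewrite pnatr_eq0 -lt0n.
rewrite divff// scale1r mul1r => /le_trans; apply.
have -> : (m * m.+1)%:R / m%:R ^+ 2 = 1 + m%:R^-1 :> R.
  by rewrite natrM -natr1; field.
move: cm; rewrite /c; lra.
Qed.

(* Baillon--Haddad: compare f - <G w, .> at its minimiser w with its value after
   a gradient step of length 1 / delta from u. *)
Lemma gradient_gap w u :
  f w <= f u + dotv (w - u) (G w)
         - (2 * delta)^-1 * dotv (G w - G u) (G w - G u).
Proof.
pose g := G u - G w; pose d := - delta^-1 *: g.
have dne : delta != 0 by rewrite gt_eqF.
have := gradient_ineq w (u + d); have := descent u d.
have -> : dotv (w - (u + d)) (G w) = dotv (w - u) (G w) - dotv d (G w).
  by rewrite !dotv_bilinear; ring.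
have -> : dotv (G w - G u) (G w - G u) = dotv g g.
  by rewrite -(opprB (G u)) dotvNl dotvNr opprK.
have gg : dotv g g = dotv g (G u) - dotv g (G w) by rewrite dotvDr dotvNr.
have dE x : dotv d x = - delta^-1 * dotv g x by rewrite dotvZl.
rewrite !dE (dotvC g d) dE.
have -> : delta / 2 * (- delta^-1 * (- delta^-1 * dotv g g)) =
          (2 * delta)^-1 * dotv g g by field.
have -> : delta^-1 = 2 * (2 * delta)^-1 by field.
rewrite gg; lra.
Qed.

(** Adding [gradient_gap] to itself with [w] and [u] exchanged cancels the values of [f]. *)
Lemma gradient_cocoercive w u :
  dotv (G w - G u) (G w - G u) <= delta * dotv (w - u) (G w - G u).
Proof.
have := gradient_gap w u; have := gradient_gap u w.
rewrite -(opprB w u) -(opprB (G w) (G u)).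
set d := w - u; set g := G w - G u; rewrite !dotvNl !dotvNr opprK.
have -> : dotv d g = dotv d (G w) - dotv d (G u) by rewrite dotvDr dotvNr.
rewrite -ler_pdivrMl// (_ : delta^-1 = 2 * (2 * delta)^-1); first by lra.
by field; rewrite gt_eqF.
Qed.

(** With [d = w - u] and [g = G w - G u], co-coercivity absorbs [mu^2 |g|^2] into the cross term.
    This leaves [- mu (2 - mu delta) <d, g>], whose coefficient has the right sign for strong
    monotonicity. *)
Lemma gradient_step_contraction (mu : R) w u : 0 < mu -> mu * delta <= 2 ->
  dotv (w - u - mu *: (G w - G u)) (w - u - mu *: (G w - G u))
  <= (1 - mu * nu * (2 - mu * delta)) * dotv (w - u) (w - u).
Proof.
move=> mu0 mud; have := gradient_cocoercive w u; have := gradient_strong_monotone w u.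
move: (G w - G u) (w - u) => g d sm cc.
rewrite !dotv_bilinear (dotvC g d).
have h1 : mu ^+ 2 * dotv g g <= mu ^+ 2 * (delta * dotv d g).
  by rewrite ler_wpM2l// sqr_ge0.
have h2 : mu * (2 - mu * delta) * (nu * dotv d d) <= mu * (2 - mu * delta) * dotv d g.
  by rewrite ler_wpM2l// mulr_ge0 ?subr_ge0// ltW.
lra.
Qed.

End StronglyConvexSmooth.

(** * Spectrum of the stacked combination matrices *)

Section CombinationMatrices.
Context {R : realType}.

(** The eigenvalue equation of a left eigenvector is read at its coordinate of largest modulus,
    where the right-hand combination is a convex one. *)
Lemma column_stochastic_eigenvalue_le1 n (M : 'M[R]_n) a :
  (forall i j, 0 <= M i j) -> (forall j, \sum_i M i j = 1) ->
  eigenvalue M a -> `|a| <= 1.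
Proof.
move=> M0 M1 /eigenvalueP[v vM v0].
have [i0 vi0] : exists i, v 0 i != 0.
  by apply/existsP; apply: contra_neqT v0 => /existsPn v0; apply/rowP => j;
    have := v0 j; rewrite negbK [RHS]mxE => /eqP.
case: (@arg_maxP _ _ 'I_n i0 xpredT (fun i => `|v 0 i|)) => // i _ imax.
have vi : 0 < `|v 0 i| by apply: lt_le_trans (imax i0 isT); rewrite normr_gt0.
rewrite -(ler_pM2r vi) mul1r -normrM.
have /rowP/(_ i) := vM; rewrite [RHS]mxE => <-; rewrite mxE.
apply: le_trans (ler_norm_sum _ _ _) _.
rewrite -[leRHS]mulr1 -(M1 i) mulr_sumr ler_sum// => j _.
by rewrite normrM (ger0_norm (M0 _ _)) ler_wpM2r//; exact: imax.
Qed.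

Lemma tensmx_ge0 m n p q (A : 'M[R]_(m, n)) (B : 'M[R]_(p, q)) :
  (forall i j, 0 <= A i j) -> (forall i j, 0 <= B i j) ->
  forall i j, 0 <= (tensmx A B) i j.
Proof. by move=> A0 B0 i j; rewrite !mxE mulr_ge0. Qed.

Lemma tensmx_colsum m n p q (A : 'M[R]_(m, n)) (B : 'M[R]_(p, q)) j :
  \sum_i (tensmx A B) i j =
  (\sum_i A i (mxtens_unindex j).1) * (\sum_i B i (mxtens_unindex j).2).
Proof. by rewrite mulr_sum; apply: eq_bigr => i _; rewrite mxE. Qed.

Lemma mxdiag_ge0 n (p : 'I_n -> nat) (D : forall e, 'M[R]_(p e)) :
  (forall e i j, 0 <= D e i j) -> forall s t, 0 <= (\mxdiag_e D e) s t.
Proof.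
move=> D0 s t; rewrite mxE.
move: (tagnat.sig1 s) (tagnat.sig1 t) (tagnat.sig2 s) (tagnat.sig2 t) => e e'.
by case: eqVneq => [->|_] i j; rewrite ?conform_mx_id// mxE.
Qed.

Lemma mxdiag_colsum1 n (p : 'I_n -> nat) (D : forall e, 'M[R]_(p e)) :
  (forall e j, \sum_i D e i j = 1) -> forall t, \sum_s (\mxdiag_e D e) s t = 1.
Proof.
move=> D1 t; transitivity (((const_mx 1 : 'rV_ _) *m (\mxdiag_e D e)) 0 t).
  by rewrite mxE; apply: eq_bigr => s _; rewrite [X in X * _]mxE mul1r.
rewrite -mxrow_const mul_mxrow_mxdiag mxE mxE -[RHS](D1 _ (tagnat.sig2 t)).
by apply: eq_bigr => i _; rewrite mxE mul1r.
Qed.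

(** An eigenvalue [l] of [(I - A) / 2] gives the eigenvalue [1 - 2 l] of the stacked matrix, which
    is column stochastic since tensoring with the identity and forming block diagonals preserve
    this. *)
Lemma combination_eigenvalue_itv (K E : nat) (S : 'I_E -> nat) (adj : rel 'I_K)
    (C : 'I_E -> {set 'I_K}) (A : forall e, 'M[R]_#|C e|) :
  (forall e, combination_matrix adj (A e)) -> forall l,
  eigenvalue (2^-1 *: (1%:M - calA (S := S) A)) l -> 0 <= l <= 1.
Proof.
move=> hA l /eigenvalueP[v vM v0].
suff : `|1 - 2 * l| <= 1 by rewrite ler_norml => /andP[? ?]; apply/andP; lra.
apply: (@column_stochastic_eigenvalue_le1 _ (calA (S := S) A)).
- apply: mxdiag_ge0 => e; apply: tensmx_ge0; first by have [_ []] := hA e.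
  by move=> i j; rewrite mxE ler0n.
- apply: mxdiag_colsum1 => e j; rewrite tensmx_colsum.
  have [_ [_ [_ ->]] _ _] := hA e; rewrite mul1r (bigD1 (mxtens_unindex j).2)//=.
  by rewrite big1 ?addr0 => [|i /negPf]; rewrite mxE ?eqxx// => ->.
apply/eigenvalueP; exists v => //; rewrite scalerBl scale1r -scalerA -vM.
rewrite -scalemxAr scalerA divff ?scale1r ?pnatr_eq0//.
by rewrite mulmxBr mulmx1 opprB addrC subrK.
Qed.

End CombinationMatrices.

(** * Full row rank of the stacked constraint matrix *)

Section ConstraintMatrix.
Context {R : realType} {K E : nat} {Q : 'I_K -> nat} {S : 'I_E -> nat}.
Variables (C : 'I_E -> {set 'I_K}) (B : forall (e : 'I_E) (k : 'I_K), 'M[R]_(S e, Q k)).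

(* Column block k of [calB] only involves the rows of the blocks e with
   k \in C e that belong to agent k, and these rows form [stackB k]. *)
Lemma calB_row_free : (forall k, row_free (stackB C B k)) -> row_free (calB C B).
Proof.
move=> Bfree; apply: inj_row_free => v.
rewrite -(submxrowK v); set u := submxrow v.
(* [z e k] is the part of [u e] held by agent [k]: the sum has one term if [k \in C e] and none
   otherwise. *)
pose z e k : 'rV[R]_(S e) :=
  \row_s \sum_(i : 'I_#|C e| | enum_val i == k) u e 0 (mxtens_index (i, s)).
pose Bblk e k : 'M[R]_(#|C e| * S e, Q k) := \matrix_(i, j)
  let: (k', s) := mxtens_unindex i in if enum_val k' == k then B e k s j else 0.
have uB e k : u e *m Bblk e k = z e k *m B e k.
  apply/rowP => j; rewrite !mxE (reindex (@mxtens_index _ _)); last first.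
    exists (@mxtens_unindex _ _) => i _; first exact: mxtens_indexK.
    exact: mxtens_unindexK.
  under eq_bigr do rewrite [X in _ * X]mxE mxtens_indexK.
  under [RHS]eq_bigr do rewrite mxE mulr_suml big_mkcond.
  rewrite exchange_big pair_bigA /=.
  by apply: eq_bigr => -[i s] _ /=; case: ifP; rewrite ?mulr0.
have zN e k : k \notin C e -> z e k = 0.
  move=> kC; apply/rowP => s; rewrite !mxE big1// => i /eqP ik.
  by rewrite -ik enum_valP in kC.
rewrite /calB mul_mxrow_mxblock -mxrow0 => /eq_mxrowP vB.
have z0 e k : z e k = 0.
  have [kC|] := boolP (k \in C e); last exact: zN.
  have eC : e \in constraints_of C k by rewrite inE.
  (* Column block [k] of the equation [v *m calB = 0] says exactly that this row is killed by
     [stackB k]. *)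
  have zk : \mxrow_(j < #|constraints_of C k|) z (enum_val j) k = 0.
    apply: (row_free_inj (Bfree k)); rewrite mul0mx mul_mxrow_mxcol.
    rewrite -(big_enum_val (fun e => z e k *m B e k)).
    rewrite -[RHS](vB k) [RHS](bigID (mem (constraints_of C k))) /=.
    rewrite [X in _ = _ + X]big1 ?addr0 => [|e']; last first.
      by rewrite inE => /zN zN'; rewrite uB zN' mul0mx.
    by apply: eq_bigr => e' _; rewrite -uB.
  move: zk; rewrite -mxrow0 => /eq_mxrowP/(_ (enum_rank_in eC e)).
  by rewrite enum_rankK_in.
rewrite -mxrow0; apply/eq_mxrowP => e; apply/rowP => i; rewrite [RHS]mxE.
rewrite -(mxtens_unindexK i); case: (mxtens_unindex i) => k s; have /rowP/(_ s) := z0 e (enum_val k).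
rewrite [LHS]mxE [RHS]mxE (big_pred1 k) => [->|k']; first by [].
by rewrite /= (inj_eq enum_val_inj).
Qed.

End ConstraintMatrix.

(** * Primal and dual energy balances, and step-size inequalities *)

Section EnergyEstimates.
Context {R : realType}.

Lemma dotv_adjoint m n (M : 'M[R]_(m, n)) x y :
  dotv x (M *m y) = dotv (M^T *m x) y.
Proof. by rewrite /dotv trmx_mul trmxK mulmxA. Qed.

Lemma wnormsq_scalar n (c : R) (x : 'cV[R]_n) : wnormsq c%:M x = c * dotv x x.
Proof. by rewrite /wnormsq mul_mx_scalar -scalemxAl mxE. Qed.

Lemma wnormsq_diag n (c : R) (lam : 'rV[R]_n) x :
  wnormsq (c *: diag_mx lam) x = c * \sum_j lam 0 j * x j 0 ^+ 2.
Proof.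
rewrite /wnormsq -scalemxAr -scalemxAl mxE; congr (_ * _); rewrite mxE.
by apply: eq_bigr => j _; rewrite mul_mx_diag !mxE; ring.
Qed.

Lemma wnormsq_Cw K E (Q : 'I_K -> nat) (S : 'I_E -> nat) (C : 'I_E -> {set 'I_K})
    (B : forall (e : 'I_E) (k : 'I_K), 'M[R]_(S e, Q k)) (mu_w mu_v : R) x :
  wnormsq (Cw C B mu_w mu_v) x =
  dotv x x - mu_w * mu_v * dotv (calB C B *m x) (calB C B *m x).
Proof.
rewrite -wnormsq_gram /wnormsq /Cw mulmxBr mulmx1 -scalemxAr mulmxBl -scalemxAl.
by rewrite mxE [X in _ + X]mxE [X in - X]mxE.
Qed.

(** After substituting for [a], both sides carry the same cross term [2 mu_w <B^T y, w>], and the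
    [|B w|^2] term of [|z|^2] is cancelled by the weight of the primal norm. *)
Lemma primal_energy m n (B : 'M[R]_(m, n)) (mu_w mu_v : R) a w y :
  mu_v != 0 -> w = a - mu_w *: (B^T *m y) ->
  let z := y + mu_v *: (B *m w) in
  dotv w w - mu_w * mu_v * dotv (B *m w) (B *m w) + mu_w / mu_v * dotv z z =
  dotv a a + mu_w / mu_v * dotv y y - mu_w ^+ 2 * dotv (B^T *m y) (B^T *m y).
Proof.
move=> mu0 wE z; have -> : a = w + mu_w *: (B^T *m y) by rewrite wE subrK.
rewrite /z !dotv_bilinear (dotvC (B *m w) y) (dotv_adjoint B y)
  (dotvC w (B^T *m y)).
by field.
Qed.

(** The update of [x] expresses [U^T z] as [mu (x - Sigma x - x')], so the claim decouples into
    coordinates. In each one the two sides, divided by [mu^2], differ by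
    [lam (1 - lam) (x - x')^2]. *)
Lemma dual_energy m r (U : 'M[R]_(m, r)) (lam : 'rV[R]_r) (mu : R) x x' y z :
  U^T *m U = 1%:M -> (forall j, 0 <= lam 0 j <= 1) -> mu != 0 ->
  x' = x - diag_mx lam *m x - mu^-1 *: (U^T *m z) ->
  y = z + mu *: (U *m (diag_mx lam *m x')) ->
  dotv y y + mu ^+ 2 * (\sum_j lam 0 j * x' j 0 ^+ 2)
  <= dotv z z + mu ^+ 2 * (\sum_j lam 0 j * (1 - lam 0 j) * x j 0 ^+ 2).
Proof.
move=> UU lam01 mu0 x'E ->; rewrite !dotv_bilinear.
set s := diag_mx lam *m x'.
have -> : dotv (U *m s) z = dotv z (U *m s) by rewrite dotvC.
have -> : dotv (U *m s) (U *m s) = dotv s s by rewrite dotv_adjoint mulmxA UU mul1mx.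
have -> : dotv z (U *m s) = mu * dotv (x - diag_mx lam *m x - x') s.
  rewrite dotv_adjoint -dotvZl; congr dotv.
  by rewrite x'E opprB addrC subrK scalerA divff// scale1r.
set D := dotv (_ - x') s.
suff : D *+ 2 + dotv s s + \sum_j lam 0 j * x' j 0 ^+ 2 <=
    \sum_j lam 0 j * (1 - lam 0 j) * x j 0 ^+ 2.
  by move/(ler_wpM2l (sqr_ge0 mu)); lra.
rewrite /D /s !dotvE -sumrMnl -!big_split ler_sum// => j _ /=.
rewrite !mul_diag_mx !mxE; have /andP[l0 l1] := lam01 j.
have : 0 <= lam 0 j * (1 - lam 0 j) * (x j 0 - x' j 0) ^+ 2.
  by apply: mulr_ge0; rewrite ?sqr_ge0// mulr_ge0// subr_ge0.
rewrite mulr2n; lra.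
Qed.

Lemma is_prox_zero n (f : 'cV[R]_n -> \bar R) (mu : R) x u :
  (forall v, f v = 0%E) -> 0 < mu -> is_prox mu f x u -> u = x.
Proof.
move=> f0 mu0 /(_ x); rewrite !f0 !add0e lee_fin !enorm_sqr subrr.
have [k0 d0] : 0 < (2 * mu)^-1 /\ dotv (0 : 'cV[R]_n) 0 = 0.
  by split; [rewrite invr_gt0 mulr_gt0 | apply/eqP; rewrite dotvv_eq0].
rewrite d0 mulr0 pmulr_rle0// => xu.
apply/esym/eqP; rewrite -subr_eq0 -dotvv_eq0.
by rewrite eq_le xu dotvv_ge0.
Qed.

Lemma is_subgradient_zero n (f : 'cV[R]_n -> \bar R) x g :
  (forall v, f v = 0%E) -> is_subgradient f x g -> g = 0.
Proof.
move=> f0 /(_ (x + g)); rewrite !f0 add0e lee_fin addrC addKr => g0.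
by apply/eqP; rewrite -dotvv_eq0 eq_le g0 dotvv_ge0.
Qed.

Lemma gamma1_itv (mu_w nu delta : R) : 0 < mu_w -> 0 < nu <= delta ->
  mu_w < (2 * delta - nu)^-1 ->
  [/\ 0 < gamma1 mu_w nu delta, gamma1 mu_w nu delta < 1 & mu_w * delta < 1].
Proof.
move=> mu0 /andP[nu0 nud] mulim; have dn0 : 0 < 2 * delta - nu by lra.
have mud : mu_w * delta < 1.
  (* [nu <= delta] gives [delta <= 2 delta - nu]. *)
  move: mulim; rewrite -[X in _ < X]mul1r ltr_pdivlMr// => /(le_lt_trans _); apply.
  by rewrite ler_pM2l//; lra.
have mun : mu_w * nu <= mu_w * delta by rewrite ler_pM2l.
have mn0 : 0 < mu_w * nu by rewrite mulr_gt0.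
have md0 : 0 < mu_w * delta by apply: lt_le_trans mun.
by split=> //; rewrite /gamma1; nra.
Qed.

(* Since mu_v lambda_max <= nu, this reduces to
   1 - mu_w nu (2 - mu_w delta) <= gamma1 (1 - mu_w nu), and the difference of
   the two sides is (mu_w nu)^2 (1 - mu_w delta). *)
Lemma gamma1_contraction (mu_w mu_v nu delta L d t : R) :
  0 < mu_w -> 0 < mu_v -> 0 < nu <= delta -> mu_w < (2 * delta - nu)^-1 ->
  mu_v * L <= nu -> 0 <= d -> t <= L * d ->
  (1 - mu_w * nu * (2 - mu_w * delta)) * d
  <= gamma1 mu_w nu delta * (d - mu_w * mu_v * t).
Proof.
move=> mw0 mv0 nud mulim Lnu d0 tL; have [g0 _ mud] := gamma1_itv mw0 nud mulim.
have td : mu_w * mu_v * t <= mu_w * nu * d.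
  rewrite -!mulrA ler_pM2l//; apply: le_trans (_ : mu_v * (L * d) <= _).
    by rewrite ler_pM2l.
  by rewrite mulrA ler_wpM2r.
apply: le_trans (_ : gamma1 mu_w nu delta * (d - mu_w * nu * d) <= _); last first.
  by rewrite ler_pM2l//; lra.
have : 0 <= (mu_w * nu) ^+ 2 * (1 - mu_w * delta) * d.
  by apply: mulr_ge0 => //; rewrite mulr_ge0 ?sqr_ge0//; lra.
rewrite /gamma1; lra.
Qed.

End EnergyEstimates.

(** * One-step contraction of the energy and geometric decay *)

Unset Implicit Arguments.

Theorem theorem2 (R : realType) (K E : nat)
  (Q : 'I_K -> nat) (S : 'I_E -> nat)
  (hE : (0 < E)%N) (hS : forall e, (0 < S e)%N)
  (adj : rel 'I_K)
  (C : 'I_E -> {set 'I_K}) (hC : forall e, (0 < #|C e|)%N)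
  (B : forall (e : 'I_E) (k : 'I_K), 'M[R]_(S e, Q k))
  (b : forall (e : 'I_E) (k : 'I_K), 'cV[R]_(S e))
  (J : forall k, 'cV[R]_(Q k) -> R)
  (Rf : forall k, 'cV[R]_(Q k) -> \bar R)
  (delta nu : R)
  (hcost : cost_assumption J Rf delta nu)
  (hnet : subnetwork_assumption adj C)
  (hdual : strong_duality_assumption C B b J Rf)
  (A : forall e, 'M[R]_#|C e|)
  (hA : forall e, combination_matrix adj (A e))
  (r : nat) (U1 : 'M[R]_(\sum_e (#|C e| * S e)%N, r)) (lam : 'rV[R]_r)
  (hU : eigendecomposition A U1 lam)
  (hR0 : forall k u, Rf k u = 0%E)
  (hrank : forall k, row_free (stackB C B k))
  (mu_w mu_v : R) (hmuw : 0 < mu_w) (hmuv : 0 < mu_v)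
  (hmuw_lt : mu_w < (2 * delta - nu)^-1)
  (hmuv_lt : mu_v < nu / lambda_max ((calB C B)^T *m calB C B))
  (wm : 'cV[R]_(\sum_k Q k)) (ym : 'cV[R]_(\sum_e (#|C e| * S e)%N))
  (w : nat -> 'cV[R]_(\sum_k Q k))
  (y : nat -> 'cV[R]_(\sum_e (#|C e| * S e)%N))
  (x : nat -> 'cV[R]_r)
  (hrun : algorithm_run B b J Rf U1 lam mu_w mu_v wm ym w y x)
  (ws : 'cV[R]_(\sum_k Q k)) (ys : 'cV[R]_(\sum_e (#|C e| * S e)%N))
  (xs : 'cV[R]_r)
  (hopt : optimality_conditions B b J Rf U1 lam ws ys xs) :
  [/\ posdef (Cw C B mu_w mu_v),
      gamma B A r mu_w mu_v nu delta < 1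
    & exists C0 : R, 0 < C0 /\
        forall i : nat,
          wnormsq (Cw C B mu_w mu_v) (ws - w i)
          + wnormsq (mu_w / mu_v)%:M (ys - y i)
          + wnormsq ((mu_w * mu_v) *: diag_mx lam) (xs - x i)
          <= gamma B A r mu_w mu_v nu delta ^+ i * C0].
Proof.
have [nud _ Glip Jsc _] := hcost.
have [UU ME lam0 _] := hU.
have [g01 g11 mud] := gamma1_itv hmuw nud hmuw_lt.
set Bm := calB C B in hmuv_lt *.
set L := lambda_max _ in hmuv_lt.
have nu0 : 0 < nu by case/andP: nud.
(* The bound on [mu_v] forces this: with [nu / 0 = 0], no positive [mu_v] is below [nu / L] when
   [L <= 0]. *)
have L0 : 0 < L.
  rewrite ltNge; apply/negP => L0; have := lt_trans hmuv hmuv_lt.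
  by rewrite pmulr_rgt0// invr_gt0 ltNge L0.
have muL : mu_v * L < nu by rewrite -ltr_pdivlMr.
have BmL x0 : dotv (Bm *m x0) (Bm *m x0) <= L * dotv x0 x0 by exact: gram_le_lambda_max.
have CwE := @wnormsq_Cw R K E Q S C B mu_w mu_v.
have Cw_pos : posdef (Cw C B mu_w mu_v).
  split=> [|x0 x00].
    by rewrite /Cw linearB linearZ /= trmx1 trmx_mul trmxK.
  have d0 : 0 < dotv x0 x0 by rewrite dotvv_gt0.
  rewrite CwE subr_gt0.
  (* The chain is [mu_w mu_v L < mu_w nu <= mu_w delta < 1]. *)
  apply: le_lt_trans (_ : mu_w * mu_v * (L * dotv x0 x0) < _).
    by rewrite ler_pM2l ?mulr_gt0.
  rewrite !mulrA -[ltRHS]mul1r ltr_pM2r// -mulrA; case/andP: nud => _ nud.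
  apply: lt_trans (_ : mu_w * nu < 1); first by rewrite ltr_pM2l.
  by apply: le_lt_trans mud; rewrite ler_pM2l.
have N0 : (0 < \sum_e (#|C e| * S e))%N.
  by rewrite (bigD1 (Ordinal hE))//= ltn_addr// muln_gt0 hC hS.
set lmin := lambda_min (Bm *m Bm^T).
have lmin0 : 0 < lmin by apply: lambda_min_gram_gt0 => //; exact: calB_row_free.
have lamE := eigenvalue_nonzero_diag UU lam0.
have lam01 j : 0 <= lam 0 j <= 1.
  apply: (@combination_eigenvalue_itv R K E S adj C A hA); rewrite ME.
  by case: (lamE (lam 0 j)) => _ /(_ (ex_intro _ j erefl)) [].
set gam := gamma _ _ _ _ _ _ _.
have [gam1 gam2 gam_lam gam_lt1] : [/\ gamma1 mu_w nu delta <= gam,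
    1 - mu_w * mu_v * lmin <= gam, forall j, 1 - lam 0 j <= gam & gam < 1].
  have g21 : 1 - mu_w * mu_v * lmin < 1 by rewrite ltrBlDr ltrDl !mulr_gt0.
  rewrite /gam /gamma /gamma2 -/Bm -/lmin.
  case: eqP => [r0|/eqP r0].
    split; rewrite ?le_max ?lexx ?orbT//; last by rewrite gt_max g11 g21.
    (* For [r = 0] there is no index [j]. *)
    by move=> j; have := ltn_ord j; rewrite [X in (_ < X)%N]r0.
  rewrite ME; have [|[j0 ljE] lmin_le] := lambda_min_nonzero_diag UU lam0.
    by rewrite lt0n.
  split; rewrite ?le_max ?lexx ?orbT//.
    by move=> j; rewrite le_max; apply/orP; right; rewrite lerB.
  (* The least nonzero eigenvalue is some [lam 0 j0], which is nonnegative and nonzero, hence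
     positive. *)
  rewrite !gt_max g11 g21 ljE ltrBlDr ltrDl lt_neqAle eq_sym lam0.
  by case/andP: (lam01 j0).
split=> //.
have gam_ge0 : 0 <= gam by apply: le_trans gam1; exact: ltW.
have R0 v : calR Rf v = 0%E by rewrite /calR big1.
have [[g [gsub stat]] Uys Bws] := hopt.
have g0 := is_subgradient_zero R0 gsub; rewrite g0 addr0 in stat.
pose V i := wnormsq (Cw C B mu_w mu_v) (ws - w i)
  + wnormsq (mu_w / mu_v)%:M (ys - y i)
  + wnormsq ((mu_w * mu_v) *: diag_mx lam) (xs - x i).
suff Vstep i : V i.+1 <= gam * V i.
  (* Adding 1 keeps the constant positive even when the initial energy vanishes. *)
  exists (`|V 0%N| + 1); split; first by rewrite ltr_wpDl.
  elim=> [|i IH]; rewrite -/(V _).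
    by rewrite expr0 mul1r (le_trans (ler_norm _))// lerDl.
  by apply: le_trans (Vstep i) _; rewrite exprS -mulrA ler_wpM2l.
have [_ /(_ i)[wstep xstep ystep]] := hrun.
have {}wstep := is_prox_zero R0 hmuw wstep.
set G := gradient (calJ J) in Glip Jsc stat wstep.
pose wt := ws - w i; pose yt := ys - y i; pose xt := xs - x i.
pose a := wt - mu_w *: (G ws - G (w i)).
pose zt := yt + mu_v *: (Bm *m (ws - w i.+1)).
have muv0 : mu_v != 0 by rewrite gt_eqF.
have {}wstep : ws - w i.+1 = a - mu_w *: (Bm^T *m yt).
  rewrite wstep /a /wt /yt mulmxBr (eqP (_ : G ws == - (Bm^T *m ys))); last first.
    by rewrite -addr_eq0 stat.
  move: (Bm^T *m ys) (Bm^T *m y i) => p q.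
  by apply/matrixP => j k; rewrite !mxE; ring.
have Bws' : Bm *m ws = calb C b - U1 *m diag_mx lam *m xs.
  by apply/eqP; rewrite -subr_eq0 opprB addrA addrAC Bws.
(* The optimality conditions eliminate [calb] and [ys], and [U1^T U1 = 1] reduces the [U1 Sigma]
   terms to [Sigma]. *)
have {}xstep : xs - x i.+1 =
    xt - diag_mx lam *m xt - mu_v^-1 *: (U1^T *m zt).
  rewrite xstep /xt /zt /yt !mulmxBr Bws' !mulmxDr -!scalemxAr !mulmxBr.
  rewrite !mulmxA UU !mul1mx Uys -!mulmxA mulmxN.
  move: (U1^T *m y i) (U1^T *m calb C b) (U1^T *m (Bm *m w i.+1)) => p q s.
  move: (diag_mx lam *m xs) (diag_mx lam *m x i) => t u.
  by apply/matrixP => j k; rewrite !mxE; field.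
have {}ystep : ys - y i.+1 = zt + mu_v *: (U1 *m (diag_mx lam *m (xs - x i.+1))).
  rewrite ystep /zt /yt !mulmxBr Bws' -!mulmxA.
  move: (U1 *m (diag_mx lam *m xs)) (U1 *m (diag_mx lam *m x i.+1)) => p q.
  move: (calb C b) (Bm *m w i.+1) => t u.
  by apply/matrixP => j k; rewrite !mxE; ring.
have primal := primal_energy muv0 wstep.
have dual := dual_energy UU lam01 muv0 xstep ystep.
have grad : dotv a a <=
    gamma1 mu_w nu delta * (dotv wt wt - mu_w * mu_v * dotv (Bm *m wt) (Bm *m wt)).
  apply: le_trans (gradient_step_contraction nud Glip Jsc _ _ hmuw _) _.
    by lra.
  apply: (gamma1_contraction (L := L)) => //; last exact: dotvv_ge0.
  exact: ltW.
have yB := gram_ge_lambda_min Bm yt.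
(* Nonnegativity of this energy allows [gamma1] to be replaced by the larger [gam]. *)
have Cwt : 0 <= dotv wt wt - mu_w * mu_v * dotv (Bm *m wt) (Bm *m wt).
  rewrite -CwE; have [->|wt0] := eqVneq wt 0; last by apply/ltW; case: Cw_pos => _; apply.
  by rewrite /wnormsq mulmx0 mxE.
rewrite /V !CwE !wnormsq_scalar !wnormsq_diag -/wt -/yt -/xt.
rewrite !mulrDr; set kap := mu_w / mu_v in primal *.
have kap0 : 0 < kap by rewrite divr_gt0.
have kapE : kap * mu_v = mu_w by rewrite divfK.
have yt_le : kap * dotv yt yt - mu_w ^+ 2 * dotv (Bm^T *m yt) (Bm^T *m yt)
    <= gam * (kap * dotv yt yt).
  apply: le_trans (_ : (1 - mu_w * mu_v * lmin) * (kap * dotv yt yt) <= _).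
    have : mu_w ^+ 2 * (lmin * dotv yt yt)
        <= mu_w ^+ 2 * dotv (Bm^T *m yt) (Bm^T *m yt).
      by rewrite ler_wpM2l// sqr_ge0.
    have -> : mu_w ^+ 2 * (lmin * dotv yt yt) =
        mu_w * mu_v * lmin * (kap * dotv yt yt).
      by rewrite expr2 -[X in _ * X * _]kapE; ring.
    lra.
  by rewrite ler_wpM2r// mulr_ge0 ?dotvv_ge0// ltW.
have xt_le : \sum_j lam 0 j * (1 - lam 0 j) * xt j 0 ^+ 2
    <= gam * \sum_j lam 0 j * xt j 0 ^+ 2.
  rewrite mulr_sumr ler_sum// => j _; rewrite mulrAC mulrC ler_wpM2r//.
  by rewrite mulr_ge0 ?sqr_ge0//; case/andP: (lam01 j).
have wt_le := ler_wpM2r Cwt gam1.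
(* Scaled by [kap], the dual balance contains the same [kap |zt|^2] as the primal one; it cancels
   when the two are added, and the three bounds by [gam] conclude. *)
have {}dual := ler_wpM2l (ltW kap0) dual.
have {}xt_le := ler_wpM2l (ltW (mulr_gt0 hmuw hmuv)) xt_le.
move: primal dual grad yt_le xt_le wt_le.
rewrite (_ : mu_w * mu_v = kap * mu_v ^+ 2); last by rewrite -kapE; ring.
cbv zeta; rewrite -/zt -/Bm; lra.
Qed.
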